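(* A $T_1$-space $X$ is metrizable if and only if $X$ is a $\beta$-space with a regular base at non-isolated points.
   Context: $I(X)$ is the set of isolated points. A base $\mathcal{B}$ is regular at $x$ if for every neighborhood $U$ of $x$ there is an open $V$ with $x\in V\subset U$ such that $\{B\in\mathcal{B}: B\cap V\neq\emptyset,\ B\not\subset U\}$ is finite; a regular base at non-isolated points is regular at every $x\in X\setminus I(X)$. A $g$-function is a map $g$ assigning to each $n\in\mathbb{N}$ and $x\in X$ an open set $g(n,x)\ni x$. $X$ is a $\beta$-space if there is a $g$-function such that whenever $x\in X$ and $\{x_n\}$ is a sequence with $x\in g(n,x_n)$ for all $n$, the sequence $\{x_n\}$ has a cluster point in $X$. *)

(* Defs.v *)
From Stdlib Require Import Reals.
Open Scope R_scope.

Record Topology (X : Type) := {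
  open : (X -> Prop) -> Prop;
  open_full : open (fun _ => True);
  open_inter : forall U V, open U -> open V -> open (fun x => U x /\ V x);
  open_union : forall F : (X -> Prop) -> Prop,
      (forall U, F U -> open U) -> open (fun x => exists U, F U /\ U x)
}.
Arguments open {X} _ _.

Definition T1 {X} (T : Topology X) : Prop :=
  forall x y : X, x <> y -> exists U, open T U /\ U x /\ ~ U y.

Definition isolated {X} (T : Topology X) (x : X) : Prop :=
  open T (fun y => y = x).

Definition is_metric {X} (d : X -> X -> R) : Prop :=
  (forall x y, 0 <= d x y) /\
  (forall x y, d x y = 0 <-> x = y) /\
  (forall x y, d x y = d y x) /\
  (forall x y z, d x z <= d x y + d y z).

Definition metrizable {X} (T : Topology X) : Prop :=
  exists d : X -> X -> R, is_metric d /\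
    forall U : X -> Prop,
      open T U <-> (forall x, U x -> exists eps, 0 < eps /\
                                   forall y, d x y < eps -> U y).

Definition is_base {X} (T : Topology X) (B : (X -> Prop) -> Prop) : Prop :=
  (forall b, B b -> open T b) /\
  (forall U x, open T U -> U x -> exists b, B b /\ b x /\ forall y, b y -> U y).

Definition finite_family {X} (F : (X -> Prop) -> Prop) : Prop :=
  exists l : list (X -> Prop),
    forall b, F b -> exists c, List.In c l /\ forall y, b y <-> c y.

Definition regular_at {X} (T : Topology X) (B : (X -> Prop) -> Prop) (x : X) : Prop :=
  forall U, open T U -> U x ->
    exists V, open T V /\ V x /\ (forall y, V y -> U y) /\
      finite_family (fun b => B b /\ (exists y, b y /\ V y) /\ ~ (forall y, b y -> U y)).

Definition regular_base_at_nonisolated {X} (T : Topology X) (B : (X -> Prop) -> Prop) : Prop :=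
  is_base T B /\ forall x, ~ isolated T x -> regular_at T B x.

Definition cluster_point {X} (T : Topology X) (s : nat -> X) (p : X) : Prop :=
  forall U, open T U -> U p -> forall N : nat, exists n, (N <= n)%nat /\ U (s n).

Definition g_function {X} (T : Topology X) (g : nat -> X -> X -> Prop) : Prop :=
  forall n x, open T (g n x) /\ g n x x.

Definition beta_space {X} (T : Topology X) : Prop :=
  exists g, g_function T g /\
    forall (x : X) (s : nat -> X), (forall n, g n (s n) x) ->
      exists p, cluster_point T s p.

(* Main.v *)
(** Let [N] be the set of non-isolated points and [B] a base regular at [N].
    Call a member of [B] [n]-deep if it has at least [n] supersets in [B].  The
    [n]-deep members cover [N], and if [x] in [U], regularity gives a
    neighbourhood [V] of [x] such that for large [n] every [n]-deep set meeting
    [V] lies in [U].  Applied to a [g]-function witnessing the beta-property and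
    cut down by deep sets, this shows that [N] is a G-delta; intersecting the
    deep sets with the open sets [G_n] shrinking to [N] and adding the isolated
    singletons yields a strong development of the whole space.  Frink's argument
    turns it into a sequence of covers in which the union of two intersecting
    members lies in a member of the previous cover, and the infimum of the chain
    costs is a metric.

    Conversely, by Stone's theorem (in M. E. Rudin's proof) a metric space has,
    for each [k], a locally finite open cover by sets of diameter at most
    [2 * (/2) ^ k]; the union of these covers is a base regular at every point. *)

Require Import Defs.
From Stdlib Require Import Reals Lra Lia List.
From Stdlib Require Import Classical ClassicalEpsilon FunctionalExtensionality PropExtensionality.
From mathcomp Require boolp wochoice.

Set Bullet Behavior "Strict Subproofs".

(** * Preliminaries: well-orderings, finite families, powers of one half *)

Lemma set_ext {X : Type} (A B : X -> Prop) : (forall x, A x <-> B x) -> A = B.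
Proof.
  intro H. apply functional_extensionality; intro x.
  apply propositional_extensionality, H.
Qed.

(** The boolean well-ordering of [wochoice] is transported to propositions. Antisymmetry comes from
    uniqueness: mutually comparable [x] and [y] are both least in the set of the two. *)
Lemma exists_well_order (X : Type) :
  exists le : X -> X -> Prop,
    (forall x y, le x y -> le y x -> x = y) /\
    (forall P : X -> Prop, (exists x, P x) ->
       exists m, P m /\ forall y, P y -> le m y).
Proof.
  destruct (wochoice.well_ordering_principle (boolp.boolp_classicType__canonical__eqtype_Equality X)) as [r Hr].
  assert (Hmin : forall P : X -> Prop, (exists x, P x) ->
            exists! m, P m /\ forall y, P y -> is_true (r m y)).
  { intros P [x Hx].
    destruct (Hr (fun z => boolp.asbool (P z))) as [m [[Hm1 Hm2] Hu]].
    - exists x. apply boolp.asboolT, Hx.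
    - exists m. split.
      + split.
        * exact (boolp.asboolW Hm1).
        * intros y Hy. apply Hm2. apply boolp.asboolT, Hy.
      + intros m' [H1 H2]. apply Hu. split.
        * apply boolp.asboolT, H1.
        * intros y Hy. apply H2. exact (boolp.asboolW Hy). }
  exists (fun x y => is_true (r x y)). split.
  - intros x y Hxy Hyx.
    assert (Hrefl : forall z, is_true (r z z)).
    { intro z. destruct (Hmin (fun w => w = z)) as [m [[-> H] _]]; [now exists z|].
      now apply H. }
    destruct (Hmin (fun w => w = x \/ w = y)) as [m [_ Hu]]; [exists x; now left|].
    transitivity m; [symmetry|]; apply Hu; (split; [tauto|]);
      intros z [->| ->]; auto.
  - intros P HP. destruct (Hmin P HP) as [m [H _]]. now exists m.
Qed.

Lemma finite_family_sub {X} (F G : (X -> Prop) -> Prop) :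
  (forall b, F b -> G b) -> finite_family G -> finite_family F.
Proof. intros H [l Hl]. exists l. auto. Qed.

Lemma finite_family_union {X} (F G : (X -> Prop) -> Prop) :
  finite_family F -> finite_family G -> finite_family (fun b => F b \/ G b).
Proof.
  intros [l Hl] [m Hm]. exists (l ++ m). intros b [H|H].
  - destruct (Hl b H) as [c [? ?]]. exists c. rewrite in_app_iff. auto.
  - destruct (Hm b H) as [c [? ?]]. exists c. rewrite in_app_iff. auto.
Qed.

Lemma finite_family_bounded_union {X} (F : nat -> (X -> Prop) -> Prop) (K : nat) :
  (forall i, (i < K)%nat -> finite_family (F i)) ->
  finite_family (fun b => exists i, (i < K)%nat /\ F i b).
Proof.
  induction K as [|K IH]; intro H.
  - exists nil. intros b [i [Hi _]]. lia.
  - apply (finite_family_sub _ (fun b => (exists i, (i < K)%nat /\ F i b) \/ F K b)).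
    + intros b [i [Hi Hb]]. destruct (Nat.eq_dec i K) as [->|]; [now right|].
      left. exists i. split; [lia|trivial].
    + apply finite_family_union; [apply IH; intros; apply H; lia|apply H; lia].
Qed.

Lemma finite_family_subsingleton {X} (F : (X -> Prop) -> Prop) :
  (forall b c, F b -> F c -> b = c) -> finite_family F.
Proof.
  intro H. destruct (classic (exists b, F b)) as [[b Hb]|Hn].
  - exists (b :: nil). intros c Hc. exists b. rewrite (H c b Hc Hb). simpl. firstorder.
  - exists nil. intros b Hb. exfalso. eauto.
Qed.

Lemma half_pow_pos (n : nat) : 0 < (/2) ^ n.
Proof. apply pow_lt. lra. Qed.

Lemma half_pow_le (m n : nat) : (m <= n)%nat -> (/2) ^ n <= (/2) ^ m.
Proof.
  induction 1 as [|n _ IH]; [lra|]. simpl. pose proof (half_pow_pos n). lra.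
Qed.

Lemma half_pow_small (eps : R) : 0 < eps -> exists n, (/2) ^ n < eps.
Proof.
  intro He. destruct (pow_lt_1_zero (/2)) with (y := eps) as [N HN]; trivial.
  - rewrite Rabs_pos_eq; lra.
  - exists N. specialize (HN N (le_n _)). rewrite Rabs_pos_eq in HN; [trivial|].
    left. apply half_pow_pos.
Qed.

(** * Stone's theorem *)

Section Stone.
  Variables (X : Type) (d : X -> X -> R) (le : X -> X -> Prop) (eps : R).
  Hypothesis dM : is_metric d.
  Hypothesis le_antisym : forall x y, le x y -> le y x -> x = y.
  Hypothesis le_least : forall P : X -> Prop, (exists x, P x) ->
       exists m, P m /\ forall y, P y -> le m y.
  Hypothesis eps_pos : 0 < eps.

  Definition least_center (a c : X) : Prop :=
    d a c < eps /\ forall b, d b c < eps -> le a b.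

  (** [P] stands for the points covered at earlier stages; only the centers [c] must avoid it, not
      the balls around them. The factor 3 is the slack that keeps the pieces of one stage apart. *)
  Definition stone_piece (P : X -> Prop) (n : nat) (a x : X) : Prop :=
    exists c, least_center a c /\ ~ P c /\
      (forall y, d c y < 3 * (/2) ^ n -> d a y < eps) /\ d c x < (/2) ^ n.

  Fixpoint stone_covered (n : nat) (x : X) : Prop :=
    match n with
    | O => False
    | S n => stone_covered n x \/ exists a, stone_piece (stone_covered n) n a x
    end.

  Definition stone_set (n : nat) : X -> X -> Prop :=
    stone_piece (stone_covered n) n.

  Lemma stone_covered_mono (m n : nat) (x : X) :
    (m <= n)%nat -> stone_covered m x -> stone_covered n x.
  Proof. induction 1; simpl; auto. Qed.

  Lemma stone_set_covered (n : nat) (a x : X) :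
    stone_set n a x -> stone_covered (S n) x.
  Proof. intro H. right. now exists a. Qed.

  Lemma stone_covered_set (n : nat) (x : X) :
    stone_covered n x -> exists m a, stone_set m a x.
  Proof.
    induction n as [|n IH]; simpl; [tauto|]. intros [H|[a H]]; [auto|].
    now exists n, a.
  Qed.

  (** Let [a] be least with [x] in its [eps]-ball. Once [3 * (/2) ^ n] is below [eps - d a x], the
      point [x] is itself an admissible center at stage [n], unless an earlier stage covers it. *)
  Lemma stone_set_cover (x : X) : exists n a, stone_set n a x.
  Proof.
    destruct dM as [dp [d0 [ds dt]]].
    destruct (le_least (fun a => d a x < eps)) as [a [Ha Hl]].
    { exists x. rewrite (proj2 (d0 x x) eq_refl). lra. }
    destruct (half_pow_small ((eps - d a x) / 3)) as [n Hn]; [lra|].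
    destruct (classic (stone_covered n x)) as [H|H].
    - now apply stone_covered_set in H.
    - exists n, a, x. repeat split; auto.
      + intros y Hy. pose proof (dt a x y). lra.
      + rewrite (proj2 (d0 x x) eq_refl). apply half_pow_pos.
  Qed.

  Lemma stone_set_open (n : nat) (a x : X) :
    stone_set n a x -> exists r, 0 < r /\ forall y, d x y < r -> stone_set n a y.
  Proof.
    destruct dM as [dp [d0 [ds dt]]].
    intros [c [H1 [H2 [H3 H4]]]]. exists ((/2) ^ n - d c x). split; [lra|].
    intros y Hy. exists c. repeat split; try apply H1; auto.
    pose proof (dt c x y). lra.
  Qed.

  Lemma stone_set_small (n : nat) (a x : X) : stone_set n a x -> d a x < eps.
  Proof.
    intros [c [_ [_ [H Hx]]]]. apply H. pose proof (half_pow_pos n). lra.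
  Qed.

  (** If [a] precedes [b], the centers behind [p] and [q] are less than [3 * (/2) ^ n] apart, so the
      center for [b] lies in the [eps]-ball of [a]. As [b] is least for that center, [b] also
      precedes [a]. *)
  Lemma stone_set_separated (n : nat) (a b p q : X) :
    stone_set n a p -> stone_set n b q -> d p q < (/2) ^ n -> a = b.
  Proof.
    destruct dM as [dp [d0 [ds dt]]].
    assert (Hlt : forall a b p q, stone_set n a p -> stone_set n b q ->
              d p q < (/2) ^ n -> le a b -> a = b).
    { intros a' b' p' q' [c [_ [_ [Hc Hp]]]] [e [[_ He] [_ [_ Hq]]]] Hpq Hab.
      apply le_antisym; trivial. apply He, Hc.
      pose proof (dt c p' e). pose proof (dt p' q' e). rewrite (ds q' e) in *. lra. }
    intros Ha Hb Hpq.
    destruct (le_least (fun z => z = a \/ z = b)) as [m [[->| ->] Hm]];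
      [exists a; auto| |].
    - eauto.
    - symmetry. rewrite ds in Hpq. eauto.
  Qed.

  (** A ball about [x] is covered at stage [n], so later centers avoid it and their shrinking balls
      eventually miss a smaller ball about [x]. Each of the finitely many remaining stages
      contributes at most one set, by separation. *)
  Lemma stone_locally_finite (x : X) :
    exists r, 0 < r /\
      finite_family (fun b => (exists n a, b = stone_set n a) /\
                              exists y, b y /\ d x y < r).
  Proof.
    destruct dM as [dp [d0 [ds dt]]].
    destruct (stone_set_cover x) as [n [a Hx]].
    destruct (stone_set_open n a x Hx) as [r [Hr Hball]].
    destruct (half_pow_small r Hr) as [j Hj].
    (* Twice this radius is at most [(/2) ^ i] for every stage [i <= n + j], as separation demands,
       and at most [(/2) ^ j < r], as needed to exclude later stages. *)
    exists ((/2) ^ (S (n + j))). split; [apply half_pow_pos|].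
    apply (finite_family_sub _ (fun b => exists i, (i < S (n + j))%nat /\
      ((exists c, b = stone_set i c) /\ exists y, b y /\ d x y < (/2) ^ (S (n + j))))).
    - intros b [[i [c ->]] [y [Hy Hxy]]]. exists i. split; [|eauto].
      destruct (Nat.lt_ge_cases i (S (n + j))) as [|Hi]; [trivial|exfalso].
      destruct Hy as [e [_ [He [_ Hey]]]]. apply He.
      apply (stone_covered_mono (S n)); [lia|].
      apply (stone_set_covered n a). apply Hball.
      pose proof (dt x y e). rewrite (ds y e) in *.
      pose proof (half_pow_le _ _ Hi).
      pose proof (half_pow_le j (n + j) ltac:(lia)).
      simpl in *. lra.
    - apply finite_family_bounded_union. intros i Hi.
      apply finite_family_subsingleton.
      intros b b' [[c ->] [y [Hy Hxy]]] [[c' ->] [y' [Hy' Hxy']]].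
      f_equal. apply (stone_set_separated i c c' y y' Hy Hy').
      pose proof (dt y x y'). rewrite (ds y x) in *.
      pose proof (half_pow_le i (n + j) ltac:(lia)). simpl in *. lra.
  Qed.
End Stone.

Lemma stone_metric_cover {X} (d : X -> X -> R) (eps : R) :
  is_metric d -> 0 < eps ->
  exists F : (X -> Prop) -> Prop,
    (forall b x, F b -> b x -> exists r, 0 < r /\ forall y, d x y < r -> b y) /\
    (forall x, exists b, F b /\ b x) /\
    (forall b x y, F b -> b x -> b y -> d x y < 2 * eps) /\
    (forall x, exists r, 0 < r /\
       finite_family (fun b => F b /\ exists y, b y /\ d x y < r)).
Proof.
  intros dM He. destruct (exists_well_order X) as [le [Hanti Hleast]].
  exists (fun b => exists n a, b = stone_set X d le eps n a). repeat split.
  - intros b x [n [a ->]]. now apply stone_set_open.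
  - intro x. destruct (stone_set_cover X d le eps dM Hleast He x) as [n [a H]].
    exists (stone_set X d le eps n a). split; [now exists n, a|trivial].
  - intros b x y [n [a ->]] Hx Hy.
    apply stone_set_small in Hx, Hy.
    destruct dM as [_ [_ [ds dt]]]. pose proof (dt x a y).
    rewrite (ds x a) in *. lra.
  - intro x. now apply stone_locally_finite.
Qed.

(** * Metrizable spaces *)

Lemma metrizable_beta_space {X} (T : Topology X) : metrizable T -> beta_space T.
Proof.
  intros [d [[dp [d0 [ds dt]]] HT]].
  exists (fun n x y => d x y < (/2) ^ n). split.
  - intros n x. split.
    + apply HT. intros y Hy. exists ((/2) ^ n - d x y). split; [lra|].
      intros z Hz. pose proof (dt x y z). lra.
    + rewrite (proj2 (d0 x x) eq_refl). apply half_pow_pos.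
  - intros x s Hs. exists x. intros U HU Hx N.
    destruct (proj1 (HT U) HU x Hx) as [e [He Hb]].
    destruct (half_pow_small e He) as [n Hn].
    exists (Nat.max N n). split; [lia|]. apply Hb.
    rewrite ds. eapply Rlt_le_trans; [apply Hs|].
    pose proof (half_pow_le n (Nat.max N n) ltac:(lia)). lra.
Qed.

Lemma min_radius (P : nat -> R -> Prop) (K : nat) :
  (forall i, exists r, 0 < r /\ P i r) ->
  (forall i r r', r' <= r -> P i r -> P i r') ->
  exists r, 0 < r /\ forall i, (i < K)%nat -> P i r.
Proof.
  intros HP Hmono. induction K as [|K [r [Hr IH]]].
  - exists 1. split; [lra|]. intros; lia.
  - destruct (HP K) as [r' [Hr' HK]]. exists (Rmin r r'). split.
    + now apply Rmin_glb_lt.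
    + intros i Hi. destruct (Nat.eq_dec i K) as [->|].
      * apply (Hmono _ r'); [apply Rmin_r|trivial].
      * apply (Hmono _ r); [apply Rmin_l|apply IH; lia].
Qed.

(** From some index on, the members of the Stone covers are too small to meet a small ball about [x]
    and still leave [U]. The finitely many earlier covers are locally finite. *)
Lemma metrizable_regular_base {X} (T : Topology X) :
  metrizable T -> exists B, is_base T B /\ forall x, regular_at T B x.
Proof.
  intros [d [dM HT]].
  destruct (choice (fun (k : nat) F => _)
     (fun k => stone_metric_cover d ((/2) ^ k) dM (half_pow_pos k))) as [F HF].
  destruct dM as [dp [d0 [ds dt]]].
  assert (d00 : forall x, d x x = 0) by (intro; now apply d0).
  exists (fun b => exists k, F k b).
  split; [split|].
  - intros b [k Hk]. apply HT. intros x Hx. now apply (HF k).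
  - intros U x HU Hx. destruct (proj1 (HT U) HU x Hx) as [e [He Hb]].
    destruct (half_pow_small (e / 2)) as [k Hk]; [lra|].
    destruct (HF k) as [_ [Hc [Hd _]]]. destruct (Hc x) as [b [Fb bx]].
    exists b. repeat split; trivial; [now exists k|].
    intros y Hy. apply Hb. pose proof (Hd b x y Fb bx Hy). lra.
  - intros x U HU Hx. destruct (proj1 (HT U) HU x Hx) as [e [He Hb]].
    (* Members of index at least [K] then have diameter below [e / 2], which together with a ball of
       radius at most [e / 2] stays within distance [e] of [x]. *)
    destruct (half_pow_small (e / 4)) as [K HK]; [lra|].
    destruct (min_radius (fun k r => finite_family
       (fun b => F k b /\ exists y, b y /\ d x y < r)) K) as [r [Hr Hfin]].
    { intro k. apply (HF k). }
    { intros k r r' Hrr. apply finite_family_sub.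
      intros b [? [y [? ?]]]. split; [trivial|]. exists y. split; [trivial|lra]. }
    exists (fun y => d x y < Rmin r (e / 2)).
    pose proof (Rmin_l r (e / 2)). pose proof (Rmin_r r (e / 2)).
    repeat split.
    + apply HT. intros y Hy. exists (Rmin r (e / 2) - d x y). split; [lra|].
      intros z Hz. pose proof (dt x y z). lra.
    + rewrite d00. apply Rmin_glb_lt; lra.
    + intros y Hy. apply Hb. lra.
    + eapply finite_family_sub; [|exact (finite_family_bounded_union _ K Hfin)].
      intros b [[k Hk] [[y [by_ Hy]] Hn]]. exists k.
      destruct (Nat.lt_ge_cases k K) as [|Hle].
      * repeat split; trivial. exists y. split; [trivial|lra].
      * exfalso. apply Hn. intros z Hz. apply Hb.
        destruct (HF k) as [_ [_ [Hd _]]]. pose proof (Hd b y z Hk by_ Hz).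
        pose proof (half_pow_le _ _ Hle). pose proof (dt x y z). lra.
Qed.

(** * Metrization from entourages *)

Section ChainMetric.
  Variables (X : Type) (E : nat -> X -> X -> Prop).
  Hypothesis E0 : forall x y, E 0 x y.
  Hypothesis E_refl : forall k x, E k x x.
  Hypothesis E_sym : forall k x y, E k x y -> E k y x.
  Hypothesis E_comp3 : forall k x y z w,
    E (S k) x y -> E (S k) y z -> E (S k) z w -> E k x w.

  (** The number of links is recorded beside the total cost so that chains can be handled by strong
      induction on length. *)
  Inductive chain : nat -> R -> X -> X -> Prop :=
  | chain_nil x : chain 0 0 x x
  | chain_cons n r k x y z :
      E k x y -> chain n r y z -> chain (S n) ((/2) ^ k + r) x z.

  Lemma chain_nonneg n r x y : chain n r x y -> 0 <= r.
  Proof.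
    induction 1 as [|n r k]; [lra|]. pose proof (half_pow_pos k). lra.
  Qed.

  Lemma chain_app n r x y m s z :
    chain n r x y -> chain m s y z -> chain (n + m) (r + s) x z.
  Proof.
    intros H K. induction H; simpl.
    - now rewrite Rplus_0_l.
    - rewrite Rplus_assoc. econstructor; eauto.
  Qed.

  Lemma chain_sym n r x y : chain n r x y -> chain n r y x.
  Proof.
    induction 1 as [|n r k x y z Hxy _ IH]; [constructor|].
    replace (S n) with (n + 1)%nat by lia.
    replace ((/2) ^ k + r) with (r + ((/2) ^ k + 0)) by ring.
    eapply chain_app; [exact IH|]. econstructor; [apply E_sym, Hxy|constructor].
  Qed.

  (** Walking along the chain, the link isolated here is the one during which the accumulated cost
      passes [t]. *)
  Lemma chain_split n r x y : chain n r x y -> forall t, 0 <= t < r ->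
    exists n1 r1 u k v n2 r2,
      chain n1 r1 x u /\ E k u v /\ chain n2 r2 v y /\
      (n1 < n)%nat /\ (n2 < n)%nat /\
      r = r1 + (/2) ^ k + r2 /\ r1 <= t < r1 + (/2) ^ k.
  Proof.
    induction 1 as [x|n r k x y z Hxy Hc IH]; intros t Ht; [lra|].
    destruct (Rlt_le_dec t ((/2) ^ k)) as [Hlt|Hle].
    - exists 0%nat, 0, x, k, y, n, r.
      repeat split; auto; try lia; try lra. constructor.
    - destruct (IH (t - (/2) ^ k)) as (n1 & r1 & u & j & v & n2 & r2 & H1 & H2 & H3 & H4 & H5 & H6 & H7);
        [lra|].
      exists (S n1), ((/2) ^ k + r1), u, j, v, n2, r2.
      repeat split; auto; try lia; try lra. econstructor; eauto.
  Qed.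

  Lemma E_mono k j x y : (k <= j)%nat -> E j x y -> E k x y.
  Proof.
    induction 1 as [|j _ IH]; [trivial|]. intro H. eauto.
  Qed.

  (* Cut the chain at the link where half of the cost is reached: both remaining
     pieces cost less than [(/2) ^ (S k)], so induction and [E_comp3] apply. *)
  Lemma chain_short n : forall k r x y, chain n r x y -> r < (/2) ^ k -> E k x y.
  Proof.
    induction n as [n IH] using (well_founded_induction Wf_nat.lt_wf).
    intros k r x y Hc Hr. pose proof (chain_nonneg _ _ _ _ Hc) as Hr0.
    destruct (Rle_lt_or_eq_dec 0 r Hr0) as [Hpos|Hzero].
    - destruct (chain_split _ _ _ _ Hc (r / 2)) as
        (n1 & r1 & u & j & v & n2 & r2 & H1 & H2 & H3 & H4 & H5 & H6 & H7); [lra|].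
      pose proof (chain_nonneg _ _ _ _ H1). pose proof (chain_nonneg _ _ _ _ H3).
      apply (E_comp3 k x u v y).
      + apply (IH n1 H4 _ r1); [trivial|simpl; lra].
      + apply (E_mono _ j); [|trivial].
        destruct (Nat.lt_ge_cases k j) as [|Hjk]; [lia|].
        pose proof (half_pow_le _ _ Hjk). lra.
      + apply (IH n2 H5 _ r2); [trivial|simpl; lra].
    - destruct Hc as [x|n' r j x y z _ Hc]; [apply E_refl|exfalso].
      pose proof (chain_nonneg _ _ _ _ Hc). pose proof (half_pow_pos j). lra.
  Qed.

  Lemma chain_pseudometric : exists d : X -> X -> R,
    (forall x y, 0 <= d x y) /\ (forall x, d x x = 0) /\
    (forall x y, d x y = d y x) /\
    (forall x y z, d x z <= d x y + d y z) /\
    (forall k x y, E k x y -> d x y <= (/2) ^ k) /\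
    (forall k x y, d x y < (/2) ^ k -> E k x y).
  Proof.
    assert (Hinf : forall p : X * X, exists m,
      (forall n r, chain n r (fst p) (snd p) -> m <= r) /\
      (forall b, (forall n r, chain n r (fst p) (snd p) -> b <= r) -> b <= m)).
    { intros [x y]; simpl.
      (* [completeness] gives suprema, so the infimum of the costs is found through their negatives.
         [E0] provides a one-link chain, so the set is inhabited. *)
      destruct (completeness (fun t => exists n r, chain n r x y /\ t = - r)) as [m [H1 H2]].
      - exists 0. intros t (n & r & H & ->). apply chain_nonneg in H. lra.
      - exists (- ((/2) ^ 0 + 0)), 1%nat, ((/2) ^ 0 + 0). split; [|trivial].
        econstructor; [apply E0|constructor].
      - exists (- m). split.
        + intros n r H. enough (- r <= m) by lra. apply H1. eauto.
        + intros b Hb. enough (m <= - b) by lra. apply H2.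
          intros t (n & r & H & ->). apply Hb in H. lra. }
    destruct (choice _ Hinf) as [f Hf].
    assert (lower : forall x y n r, chain n r x y -> f (x, y) <= r).
    { intros x y n r H. destruct (Hf (x, y)) as [H1 _]. eapply H1, H. }
    assert (greatest : forall x y b,
               (forall n r, chain n r x y -> b <= r) -> b <= f (x, y)).
    { intros x y b H. destruct (Hf (x, y)) as [_ H2]. now apply H2. }
    assert (nonneg : forall x y, 0 <= f (x, y)).
    { intros x y. apply greatest. intros n r. apply chain_nonneg. }
    exists (fun x y => f (x, y)). repeat split.
    - exact nonneg.
    - intro x. apply Rle_antisym; [|apply nonneg]. eapply lower, chain_nil.
    - intros x y. apply Rle_antisym; apply greatest; intros n r H;
        eapply lower, chain_sym, H.
    - intros x y z. enough (f (x, z) - f (x, y) <= f (y, z)) by lra.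
      apply greatest. intros m s Hs.
      enough (f (x, z) - s <= f (x, y)) by lra.
      apply greatest. intros n r Hr.
      pose proof (lower _ _ _ _ (chain_app _ _ _ _ _ _ _ Hr Hs)). lra.
    - intros k x y H. replace ((/2) ^ k) with ((/2) ^ k + 0) by ring.
      eapply lower. econstructor; [exact H|constructor].
    - intros k x y H. apply NNPP; intro Hn. apply (Rlt_not_le _ _ H).
      apply greatest. intros n r Hc. apply Rnot_lt_le. intro Hr.
      apply Hn. eapply chain_short; eauto.
  Qed.
End ChainMetric.

(** * Metrization from linked open covers *)

Lemma open_ext {X} (T : Topology X) (V U : X -> Prop) :
  (forall x, U x <-> V x) -> open T V -> open T U.
Proof. intro H. now rewrite (set_ext U V H). Qed.

Lemma open_local {X} (T : Topology X) (U : X -> Prop) :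
  (forall x, U x -> exists V, open T V /\ V x /\ forall y, V y -> U y) -> open T U.
Proof.
  intro H.
  apply (open_ext T (fun x => exists V, (open T V /\ forall y, V y -> U y) /\ V x)).
  - intro x. split.
    + intro Hx. destruct (H x Hx) as [V [? [? ?]]]. eauto.
    + intros [V [[_ HV] Hx]]. auto.
  - apply open_union. now intros V [HV _].
Qed.

Definition meets {X} (A B : X -> Prop) : Prop := exists x, A x /\ B x.
Definition included {X} (A B : X -> Prop) : Prop := forall x, A x -> B x.

(** Points are close when they share a member of a cover. Linking makes this relation transitive at
    the price of one level, which suffices for the chain pseudometric; the T1 axiom makes it a
    metric. *)
Lemma metrizable_of_linked_covers {X} (T : Topology X) (W : nat -> X -> X -> Prop) :
  T1 T ->
  (forall k x, open T (W k x)) -> (forall k x, W k x x) ->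
  (forall k x y, meets (W (S k) x) (W (S k) y) ->
     exists z, included (W (S k) x) (W k z) /\ included (W (S k) y) (W k z)) ->
  (forall x U, open T U -> U x ->
     exists k, forall y, W k y x -> included (W k y) U) ->
  metrizable T.
Proof.
  intros HT1 Wo Wx Wlink Wsmall.
  (* The shift by one frees level 0 for the total relation that [E0] asks for. *)
  set (A := fun k x y => match k with O => True | S j => exists z, W j z x /\ W j z y end).
  assert (Ar : forall k x, A k x x).
  { intros [|k] x; simpl; [trivial|]. exists x. auto. }
  assert (As : forall k x y, A k x y -> A k y x).
  { intros [|k] x y; simpl; [trivial|]. intros [z [? ?]]. eauto. }
  assert (At : forall k x y z, A (S k) x y -> A (S k) y z -> A k x z).
  { intros [|k] x y z; simpl; [trivial|]. intros [u [? ?]] [v [? ?]].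
    destruct (Wlink k u v) as [w [Hu Hv]]; [now exists y|].
    exists w. auto. }
  (* Composing two relations loses one level and composing three loses two, so only the even levels
     are kept. *)
  destruct (chain_pseudometric X (fun k => A (k + k)%nat)) as (d & dp & d00 & ds & dt & dle & dlt).
  - simpl; trivial.
  - auto.
  - auto.
  - intros k x y z w Hxy Hyz Hzw.
    replace (S k + S k)%nat with (S (S (k + k))) in * by lia.
    apply (At _ x z w); [|exact (At _ z w w Hzw (Ar _ _))].
    exact (At _ x y z Hxy Hyz).
  - assert (Amono : forall k j x y, (k <= j)%nat -> A j x y -> A k x y).
    { induction 1 as [|j _ IH]; [trivial|]. intro H. apply IH.
      exact (At _ x y y H (Ar _ _)). }
    assert (Hsmall : forall x U, open T U -> U x ->
              exists e, 0 < e /\ forall y, d x y < e -> U y).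
    { intros x U HU Hx. destruct (Wsmall x U HU Hx) as [k Hk].
      exists ((/2) ^ (S k)). split; [apply half_pow_pos|].
      intros y Hy. apply dlt in Hy.
      apply (Amono (S k)) in Hy; [|lia]. destruct Hy as [z [Hzx Hzy]].
      exact (Hk z Hzx y Hzy). }
    exists d. split.
    + split; [exact dp|]. split; [|split; [exact ds|exact dt]].
      intros x y. split; [|intros ->; apply d00].
      intro H. apply NNPP; intro Hne.
      destruct (HT1 x y Hne) as [U [HU [Ux Uy]]].
      destruct (Hsmall x U HU Ux) as [e [He Hb]].
      apply Uy, Hb. lra.
    + intro U. split; [intros; now apply Hsmall|].
      intro H. apply open_local. intros x Hx.
      destruct (H x Hx) as [e [He Hb]].
      destruct (half_pow_small e He) as [k Hk].
      exists (W (k + k)%nat x). repeat split; auto.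
      intros y Hy. apply Hb.
      enough (d x y <= (/2) ^ k) by lra. apply dle.
      apply (Amono _ (S (k + k))); [lia|]. exists x. auto.
Qed.

(** * Strong developments *)

Definition star {X} (C : (X -> Prop) -> Prop) (x y : X) : Prop :=
  exists b, C b /\ b x /\ b y.

(** The covers need not refine one another, so one [V] has to serve all sufficiently late covers. *)
Definition strong_development {X} (T : Topology X)
    (C : nat -> (X -> Prop) -> Prop) : Prop :=
  (forall n b, C n b -> open T b) /\
  (forall n x, exists b, C n b /\ b x) /\
  (forall x U, open T U -> U x -> exists V m, open T V /\ V x /\
     forall n b, (m <= n)%nat -> C n b -> meets b V -> included b U).

Section Frink.
  Variables (X : Type) (T : Topology X) (C : nat -> (X -> Prop) -> Prop).
  Hypothesis HC : strong_development T C.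

  Lemma star_open n x : open T (star (C n) x).
  Proof.
    destruct HC as [Co _]. apply open_local. intros y [b [Hb [Hx Hy]]].
    exists b. repeat split; eauto. intros z Hz. exists b. auto.
  Qed.

  Lemma star_refl n x : star (C n) x x.
  Proof.
    destruct HC as [_ [Cc _]]. destruct (Cc n x) as [b [? ?]]. exists b. auto.
  Qed.

  (** Absorption is used twice. A member of the star that meets [V2] lies in [V1], hence [y] is in
      [V1]; then every member containing [y] meets [V1] and lies in [U]. *)
  Lemma star_absorbed x U : open T U -> U x -> exists V m,
    open T V /\ V x /\
    forall n y, (m <= n)%nat -> meets (star (C n) y) V -> included (star (C n) y) U.
  Proof.
    destruct HC as [_ [_ Cs]]. intros HU Hx.
    destruct (Cs x U HU Hx) as (V1 & m1 & V1o & V1x & H1).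
    destruct (Cs x V1 V1o V1x) as (V2 & m2 & V2o & V2x & H2).
    exists V2, (Nat.max m1 m2). repeat split; trivial.
    intros n y Hn [z [[b [Hb [by_ bz]]] Vz]].
    assert (Vy : V1 y).
    { apply (H2 n b); [lia|trivial|now exists z|trivial]. }
    intros w [c [Hc [cy cw]]].
    apply (H1 n c); [lia|trivial|now exists y|trivial].
  Qed.

  (** For large [m'] the star of [x] is contained in the neighbourhood [V] whose late visitors are
      absorbed by the star at level [m]. *)
  Lemma star_step x m : exists m', (m < m')%nat /\
    forall n y, (m' <= n)%nat -> meets (star (C n) y) (star (C m') x) ->
      included (star (C n) y) (star (C m) x).
  Proof.
    destruct (star_absorbed x _ (star_open m x) (star_refl m x)) as (V & k & Vo & Vx & H).
    destruct HC as [_ [_ Cs]]. destruct (Cs x V Vo Vx) as (V' & j & _ & Vx' & H').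
    exists (S (Nat.max m (Nat.max k j))). split; [lia|].
    intros n y Hn [z [Hy [b [Hb [bx bz]]]]].
    apply H; [lia|]. exists z. split; [trivial|].
    eapply H'; [|exact Hb|now exists x|exact bz]. lia.
  Qed.

  (* Frink's trick: along [level x k], the point with the smaller level absorbs
     the other, whence stars of successive levels form linked covers. *)
  Lemma strong_development_metrizable : T1 T -> metrizable T.
  Proof.
    intro HT1.
    destruct (choice (fun (p : X * nat) m' => _) (fun p => star_step (fst p) (snd p)))
      as [next Hnext].
    set (level := fun (x : X) => fix level (k : nat) :=
           match k with O => O | S k => next (x, level k) end).
    assert (Hlev : forall x k, (level x k < level x (S k))%nat /\
       forall n y, (level x (S k) <= n)%nat ->
         meets (star (C n) y) (star (C (level x (S k))) x) ->
         included (star (C n) y) (star (C (level x k)) x)).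
    { intros x k. exact (Hnext (x, level x k)). }
    (* Levels depend on the point; this uniform lower bound puts all of them beyond the threshold
       [m] of [star_absorbed] at once. *)
    assert (Hge : forall x k, (k <= level x k)%nat).
    { intros x k. induction k as [|k IH]; [lia|]. pose proof (proj1 (Hlev x k)). lia. }
    apply (metrizable_of_linked_covers T (fun k x => star (C (level x k)) x) HT1).
    - intros. apply star_open.
    - intros. apply star_refl.
    - assert (Hw : forall k x y, (level x (S k) <= level y (S k))%nat ->
        meets (star (C (level x (S k))) x) (star (C (level y (S k))) y) ->
        included (star (C (level x (S k))) x) (star (C (level x k)) x) /\
        included (star (C (level y (S k))) y) (star (C (level x k)) x)).
      { intros k x y Hle [z [Hx Hy]]. split; apply Hlev; trivial; exists z; auto. }
      intros k x y [z [Hx Hy]].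
      destruct (Nat.le_ge_cases (level x (S k)) (level y (S k))) as [H|H].
      + exists x. apply Hw; [trivial|]. exists z; auto.
      + exists y. apply and_comm, Hw; [trivial|]. exists z; auto.
    - intros x U HU Hx. destruct (star_absorbed x U HU Hx) as (V & m & _ & Vx & H).
      exists m. intros y Hy. apply H; [apply Hge|]. now exists x.
  Qed.
End Frink.

(** * Bases regular at the non-isolated points *)

(** The list may contain [b] itself. Fixing its length at [n] still expresses at least [n]
    supersets, since a longer list without repetitions can be truncated. *)
Definition deep {X} (B : (X -> Prop) -> Prop) (n : nat) (b : X -> Prop) : Prop :=
  B b /\ exists l, NoDup l /\ length l = n /\
    forall c, In c l -> B c /\ included b c.

(* If [b] meets [V] without lying in [U], then so do all its supersets in [B],
   and regularity bounds their number. *)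
Lemma deep_regular {X} (T : Topology X) B x U :
  regular_at T B x -> open T U -> U x -> exists V m, open T V /\ V x /\
    forall n b, (m <= n)%nat -> deep B n b -> meets b V -> included b U.
Proof.
  intros HB HU Hx. destruct (HB U HU Hx) as (V & Vo & Vx & _ & l & Hl).
  exists V, (S (length l)). repeat split; trivial.
  intros n b Hn [Hb [k [Hnd [Hk Hin]]]] [z [bz Vz]]. apply NNPP. intro Hnot.
  enough (length k <= length l)%nat by lia.
  apply NoDup_incl_length; [trivial|]. intros c Hc.
  destruct (Hin c Hc) as [Bc bc]. destruct (Hl c) as [c' [Hc' Heq]].
  - repeat split; [trivial|exists z; auto|]. intro Hcu. apply Hnot. intros y Hy. auto.
  - now rewrite (set_ext _ _ Heq).
Qed.

Lemma T1_open_neq {X} (T : Topology X) (x : X) : T1 T -> open T (fun y => y <> x).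
Proof.
  intro H. apply open_local. intros y Hy. destruct (H y x Hy) as [U [? [? Hx]]].
  exists U. repeat split; trivial. now intros z Hz ->.
Qed.

Lemma open_isolated {X} (T : Topology X) : open T (isolated T).
Proof.
  apply open_local. intros x Hx. exists (fun y => y = x). repeat split; trivial.
  now intros y ->.
Qed.

Lemma open_list_inter {X} (T : Topology X) (l : list (X -> Prop)) :
  (forall b, In b l -> open T b) -> open T (fun x => forall b, In b l -> b x).
Proof.
  induction l as [|a l IH]; intro H.
  - apply (open_ext T (fun _ => True)); [|apply open_full].
    intro x. split; [trivial|]. now intros _ b Hb.
  - apply (open_ext T (fun x => a x /\ forall b, In b l -> b x)).
    + intro x. simpl. split.
      * intro Hx. split; [|intros b Hb]; apply Hx; auto.
      * intros [Ha Hl] b [<-|Hb]; [exact Ha|exact (Hl b Hb)].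
    + apply open_inter; [apply H; now left|]. apply IH. intros b Hb. apply H. now right.
Qed.

Lemma open_bounded_inter {X} (T : Topology X) (G : nat -> X -> Prop) (n : nat) :
  (forall k, open T (G k)) -> open T (fun x => forall k, (k <= n)%nat -> G k x).
Proof.
  intro H.
  apply (open_ext T (fun x => forall b, In b (map G (seq 0 (S n))) -> b x)).
  - intro x. split.
    + intros Hx b Hb. apply in_map_iff in Hb as [k [<- Hk]]. apply in_seq in Hk.
      apply Hx. lia.
    + intros Hx k Hk. apply Hx, in_map, in_seq. lia.
  - apply open_list_inter. intros b Hb. apply in_map_iff in Hb as [k [<- _]]. apply H.
Qed.

(** The members found so far intersect in an open set that contains some [y] other than [x]. By T1 a
    base member about [x] misses [y], hence is new. *)
Lemma nonisolated_base_members {X} (T : Topology X) B x n :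
  T1 T -> is_base T B -> ~ isolated T x ->
  exists l, NoDup l /\ length l = n /\ forall b, In b l -> B b /\ b x.
Proof.
  intros HT1 [Bo Bb] Hx. induction n as [|n (l & Hnd & Hl & Hin)].
  - exists nil. repeat split; [constructor|easy|easy].
  - set (V := fun y => forall b, In b l -> b y).
    assert (Vo : open T V).
    { apply open_list_inter. intros b Hb. apply Bo, Hin, Hb. }
    assert (Vx : V x) by (intros b Hb; now apply Hin).
    assert (Hy : exists y, V y /\ y <> x).
    { apply NNPP. intro Hno. apply Hx. apply (open_ext T V); [|trivial].
      intro y. split; [now intros ->|]. intro Vy. apply NNPP. intro Hne. eauto. }
    destruct Hy as [y [Vy Hyx]].
    destruct (Bb _ x (T1_open_neq T y HT1)) as (b & HBb & bx & Hby); [congruence|].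
    exists (b :: l). repeat split.
    + constructor; [|trivial]. intro Hbl. exact (Hby y (Vy b Hbl) eq_refl).
    + simpl. now rewrite Hl.
    + destruct H as [<-|H]; [trivial|now apply Hin].
    + destruct H as [<-|H]; [trivial|now apply Hin].
Qed.

(** A base member inside the intersection of [n] distinct members about [x] has all of them as
    supersets. *)
Lemma deep_cover {X} (T : Topology X) B x n :
  T1 T -> is_base T B -> ~ isolated T x -> exists b, deep B n b /\ b x.
Proof.
  intros HT1 HB Hx.
  destruct (nonisolated_base_members T B x n HT1 HB Hx) as (l & Hnd & Hl & Hin).
  destruct HB as [Bo Bb].
  destruct (Bb (fun y => forall b, In b l -> b y) x) as (b & HBb & bx & Hb).
  - apply open_list_inter. intros b Hb. apply Bo, Hin, Hb.
  - intros b Hb. now apply Hin.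
  - exists b. split; [split; [trivial|]|trivial].
    exists l. repeat split; trivial; [now apply Hin|]. intros y Hy. now apply Hb.
Qed.

(** If an isolated [y] lay in every [G n], the witnessing non-isolated points would cluster at some
    [p]. Near [p] the late deep sets avoid [y], although each of them was chosen to contain [y]. *)
Lemma beta_nonisolated_Gdelta {X} (T : Topology X) B :
  T1 T -> beta_space T -> regular_base_at_nonisolated T B ->
  exists G : nat -> X -> Prop,
    (forall n, open T (G n)) /\
    (forall n x, ~ isolated T x -> G n x) /\
    (forall x, isolated T x -> exists n, ~ G n x).
Proof.
  intros HT1 [g [Hg Hbeta]] [HB Hreg].
  exists (fun n y => exists x b, ~ isolated T x /\ deep B n b /\ b x /\ b y /\ g n x y).
  split; [|split].
  - intro n. apply open_local. intros y (x & b & Hx & Hb & bx & by_ & gy).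
    exists (fun z => b z /\ g n x z). repeat split; trivial.
    + apply open_inter; [apply HB, Hb|apply Hg].
    + intros z [? ?]. exists x, b. auto.
  - intros n x Hx. destruct (deep_cover T B x n HT1 HB Hx) as [b [Hb bx]].
    exists x, b. repeat split; trivial; try apply Hb. apply Hg.
  - intros y Hy. apply NNPP. intro Hno.
    assert (Hall : forall n, exists p : X * (X -> Prop), ~ isolated T (fst p) /\
      deep B n (snd p) /\ snd p (fst p) /\ snd p y /\ g n (fst p) y).
    { intro n. apply NNPP. intro H. apply Hno. exists n. intros (x & b & H').
      apply H. exists (x, b). exact H'. }
    destruct (choice _ Hall) as [s Hs].
    destruct (Hbeta y (fun n => fst (s n))) as [p Hp].
    { intro n. apply Hs. }
    assert (Hpn : ~ isolated T p).
    (* The isolated points form an open set, and no term of the sequence lies in it. *)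
    { intro Hpi. destruct (Hp _ (open_isolated T) Hpi 0%nat) as [n [_ Hn]].
      now apply (proj1 (Hs n)). }
    destruct (deep_regular T B p (fun z => z <> y) (Hreg p Hpn)) as (V & m & Vo & Vp & HV).
    + now apply T1_open_neq.
    + now intros ->.
    + destruct (Hp V Vo Vp m) as [n [Hn Vn]].
      destruct (Hs n) as (_ & Hd & Hsn & Hsy & _).
      apply (HV n (snd (s n)) Hn Hd) in Hsy; [congruence|]. now exists (fst (s n)).
Qed.

Lemma beta_regular_base_strong_development {X} (T : Topology X) B :
  T1 T -> beta_space T -> regular_base_at_nonisolated T B ->
  exists C, strong_development T C.
Proof.
  intros HT1 Hbeta HRB.
  destruct (beta_nonisolated_Gdelta T B HT1 Hbeta HRB) as (G & Go & Gn & Gi).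
  destruct HRB as [HB Hreg].
  exists (fun n c => (exists x, isolated T x /\ c = fun y => y = x) \/
     exists b, deep B n b /\ c = fun y => b y /\ forall k, (k <= n)%nat -> G k y).
  split; [|split].
  - intros n c [[x [Hx ->]]|[b [Hb ->]]]; [exact Hx|].
    apply open_inter; [apply HB, Hb|now apply open_bounded_inter].
  - intros n x. destruct (classic (isolated T x)) as [Hx|Hx].
    + exists (fun y => y = x). split; [left; now exists x|trivial].
    + destruct (deep_cover T B x n HT1 HB Hx) as [b [Hb bx]].
      exists (fun y => b y /\ forall k, (k <= n)%nat -> G k y). split; [eauto|].
      split; auto.
  - intros x U HU Ux. destruct (classic (isolated T x)) as [Hx|Hx].
    (* From index [m] on, every trimmed deep set lies in [G m] and so misses [x]; only the singleton
       of [x] meets [V]. *)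
    + destruct (Gi x Hx) as [m Hm]. exists (fun y => y = x), m. repeat split; trivial.
      intros n c Hn [[y [_ ->]]|[b [_ ->]]] [z [Hz ->]].
      * intros w ->. now rewrite <- Hz.
      * exfalso. now apply Hm, Hz.
    + destruct (deep_regular T B x U (Hreg x Hx) HU Ux) as (V & m & Vo & Vx & HV).
      (* Cutting [V] down to [U] handles the isolated singletons: one that meets it lies in [U]. *)
      exists (fun y => V y /\ U y), m. repeat split; trivial; [now apply open_inter|].
      intros n c Hn [[y [_ ->]]|[b [Hb ->]]] [z [Hz [Vz Uz]]].
      * subst z. now intros w ->.
      * intros w [bw _]. apply (HV n b Hn Hb); [|trivial]. exists z. split; [apply Hz|trivial].
Qed.

Theorem mainTheorem11 (X : Type) (T : Topology X) :
  T1 T ->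
  (metrizable T <->
   (beta_space T /\ exists B, regular_base_at_nonisolated T B)).
Proof.
  intro HT1. split.
  - intro HM. split; [now apply metrizable_beta_space|].
    destruct (metrizable_regular_base T HM) as [B [HB Hreg]].
    exists B. split; auto.
  - intros [Hbeta [B HB]].
    destruct (beta_regular_base_strong_development T B HT1 Hbeta HB) as [C HC].
    now apply (strong_development_metrizable X T C).
Qed.
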